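(* Let $1\le p<q\le\infty$ with $q\ge2$, and let $K>1$ and $\sigma>0$. Then $$\bar n^{\mathrm{wor}}(\varepsilon,\delta,\mathcal Y_{p,q,K}\cap\sigma\mathcal B_2)\ \ge\ \frac1{4\log3}\left(\frac\sigma\varepsilon\right)^2\log\left(\tfrac43\delta\right)^{-1}$$ for any $0<\varepsilon\le\min\{1-2/(K+1),\,1/2\}\,\sigma$ and $0<\delta\le1/4$, where $\log\left(\tfrac43\delta\right)^{-1}$ denotes $\log\left(1/(\tfrac43\delta)\right)$.
   Context: Random variables are real-valued on a probability space $(\Omega,\Sigma,\mathbb P)$, assumed rich enough to carry all random variables considered (random variables with arbitrary distributions, sequences of i.i.d. copies, independent auxiliary randomness). $\|X\|_q=(\mathbb E|X|^q)^{1/q}$ for $q<\infty$ and $\|X\|_\infty$ is the essential supremum of $|X|$. For $1\le p<q\le\infty$, $K>1$, $\sigma>0$, $$\mathcal Y_{p,q,K}:=\{Y\in L_q\mid \|Y-\mathbb E Y\|_q\le K\|Y-\mathbb E Y\|_p\},\qquad \sigma\mathcal B_2:=\{Y\in L_2\mid\|Y-\mathbb E Y\|_2\le\sigma\}.$$ An i.i.d.-based algorithm on a class $\mathcal Y$ of random variables consists of: an auxiliary random variable $U$ with values in a measurable space $(\mathbb U,\Sigma_U)$; a measurable $\phi:\mathbb U\times\mathbb R^{\mathbb N}\to\mathbb R$; and a measurable stopping rule $n:\mathbb U\times\mathbb R^{\mathbb N}\to\mathbb N_0\cup\{\infty\}$ such that whether $n(u,(y_j)_j)\ge i$ depends only on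 $(u,y_1,\dots,y_{i-1})$. For $Y\in\mathcal Y$ with i.i.d. copies $(Y_i)_{i\in\mathbb N}$, independent of $U$, put $n(\omega,Y):=n(U(\omega),(Y_i(\omega))_i)$, assumed almost surely finite for each $Y\in\mathcal Y$, and $A(\omega,Y):=\phi(U(\omega),Y_1(\omega),\dots,Y_{n(\omega,Y)}(\omega),0,0,\dots)$; $A(Y):=A(\cdot,Y)$. The algorithm is $(\varepsilon,\delta)$-approximating on $\mathcal Y$ if $\mathbb P\{|A(Y)-\mathbb E Y|\le\varepsilon\}\ge1-\delta$ for all $Y\in\mathcal Y$. The expected cost is $\bar n(A,Y):=\mathbb E\,n(\cdot,Y)$, the worst case cost is $\bar n^{\mathrm{wor}}(A,\mathcal Y):=\sup_{Y\in\mathcal Y}\bar n(A,Y)$, and the worst case complexity is $$\bar n^{\mathrm{wor}}(\varepsilon,\delta,\mathcal Y):=\inf\{n>0\mid\exists\ (\varepsilon,\delta)\text{-approximating i.i.d.-based } A\text{ on }\mathcal Y\text{ with }\bar n^{\mathrm{wor}}(A,\mathcal Y)\le n\}.$$ *)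

(* Defs.v *)
From HB Require Import structures.
From mathcomp Require Import all_boot all_order all_algebra finmap.
From mathcomp Require Import all_classical all_reals all_analysis.

Set Implicit Arguments.
Unset Strict Implicit.
Unset Printing Implicit Defensive.

Import Order.TTheory GRing.Theory Num.Theory.
Import numFieldNormedType.Exports.

Local Open Scope classical_set_scope.
Local Open Scope ring_scope.

(* The space R^N with its product sigma-algebra, generated by the coordinates. *)
Definition coordinate_sets (R : realType) : set (set (nat -> R)) :=
  \bigcup_i preimage_set_system setT (fun y : nat -> R => y i) measurable.

Definition real_seq (R : realType) := g_sigma_algebraType (@coordinate_sets R).

(* Elements of N_0 extended by infinity are represented by option nat, with
   None for infinity. *)
Definition enat_ge (i : nat) (m : option nat) : bool :=
  if m is Some k then (i <= k)%N else true.

Definition enat_val (R : realType) (m : option nat) : \bar R :=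
  if m is Some k then (k%:R)%:E else +oo%E.

Definition keep_first (R : realType) (m : option nat) (y : nat -> R) :
    nat -> R :=
  fun i => if m is Some k then (if (i < k)%N then y i else 0) else y i.

Section Sampling.
Context (d : measure_display) (T : measurableType d) (R : realType).
Variable P : probability T R.

(* A space carrying one variable of each law is atomless, hence it also carries
   i.i.d. sequences with any given law, together with an independent uniform
   random variable. *)
Definition rich : Prop :=
  forall mu : probability (measurableTypeR R) R,
    exists X : {RV P >-> R},
      forall B : set R, measurable B -> distribution P X B = mu B.

Definition mutually_independent (I : choiceType) (F : I -> set (set T)) : Prop :=
  forall (J : {fset I}) (E : I -> set T), (forall i, i \in J -> F i (E i)) ->
    P (\bigcap_(i in [set` J]) E i) = (\prod_(i <- J) P (E i))%E.

Definition same_law (X Y : {RV P >-> R}) : Prop :=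
  forall B : set R, measurable B -> distribution P X B = distribution P Y B.

(* The sigma-algebras generated by U (index None) and by each Ys i. *)
Definition generated_sigma (d' : measure_display) (T' : measurableType d')
    (U : {RV P >-> T'}) (Ys : nat -> {RV P >-> R}) (o : option nat) :
    set (set T) :=
  if o is Some i then g_sigma_algebra_preimage (Ys i)
  else g_sigma_algebra_preimage U.

Definition centered (Y : {RV P >-> R}) : T -> R :=
  fun w => Y w - fine 'E_P[Y]%E.

Definition class_Y (p q : \bar R) (K : R) : set {RV P >-> R} :=
  [set Y : {RV P >-> R} | (Y : T -> R) \in Lfun P q /\
    ('N[P]_q[EFin \o centered Y] <= K%:E * 'N[P]_p[EFin \o centered Y])%E].

Definition sigma_ball2 (sigma : R) : set {RV P >-> R} :=
  [set Y : {RV P >-> R} | (Y : T -> R) \in Lfun P 2%:E /\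
    ('N[P]_2%:E[EFin \o centered Y] <= sigma%:E)%E].

(* [copies Y] is the i.i.d. sample fed to the algorithm on input Y; it is stored
   with the algorithm so that the sample exists on T jointly with [aux]. The
   choice is immaterial: the laws of the cost and of the output on input Y are
   determined by the laws of [aux] and Y. Samples are indexed from 0, so Y_i of
   the mathematical text is [copies Y i.-1]. *)
Record iid_algorithm (C : set {RV P >-> R}) := IidAlgorithm {
  aux_display : measure_display ;
  aux_space : measurableType aux_display ;
  aux : {RV P >-> aux_space} ;
  phi : {mfun (aux_space * real_seq R)%type >-> R} ;
  stop : aux_space * real_seq R -> option nat ;
  stop_measurable : forall B : set (option nat), measurable (stop @^-1` B) ;
  stop_nonanticipating : forall (i : nat) (u : aux_space) (y y' : real_seq R),
    (forall j, (j.+1 < i)%N -> y j = y' j) ->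
    enat_ge i (stop (u, y)) = enat_ge i (stop (u, y')) ;
  copies : {RV P >-> R} -> nat -> {RV P >-> R} ;
  copies_law : forall Y, C Y -> forall i, same_law (copies Y i) Y ;
  copies_independent : forall Y, C Y ->
    mutually_independent (generated_sigma aux (copies Y)) ;
  stop_finite : forall Y, C Y ->
    {ae P, forall w, stop (aux w, fun i => copies Y i w) <> None} }.

Arguments aux {C} _.
Arguments phi {C} _.
Arguments stop {C} _ _.
Arguments copies {C} _ _ _.

Section Runs.
Variables (C : set {RV P >-> R}) (A : iid_algorithm C).

Definition run_length (Y : {RV P >-> R}) (w : T) : option nat :=
  stop A (aux A w, fun i => copies A Y i w).

Definition run_output (Y : {RV P >-> R}) (w : T) : R :=
  phi A (aux A w, keep_first (run_length Y w) (fun i => copies A Y i w)).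

Definition approximating (eps delta : R) : Prop :=
  forall Y, C Y ->
    ((1 - delta)%:E <=
      P [set w | (`|run_output Y w - fine 'E_P[Y]%E| <= eps)%R])%E.

Definition expected_cost (Y : {RV P >-> R}) : \bar R :=
  (\int[P]_w enat_val R (run_length Y w))%E.

Definition worst_cost : \bar R := ereal_sup [set expected_cost Y | Y in C].

End Runs.

Definition worst_complexity (eps delta : R) (C : set {RV P >-> R}) : \bar R :=
  ereal_inf [set n%:E | n in [set n : R | 0 < n /\
    exists A : iid_algorithm C,
      approximating A eps delta /\ (worst_cost A <= n%:E)%E]].

End Sampling.

Arguments class_Y {d T R} P p q K _.
Arguments sigma_ball2 {d T R} P sigma _.

(* Main.v *)
(* Let eta = eps / sigma, and let Y+ and Y- take the values s and -s, where
   s = sigma / sqrt (1 - eta^2), with P(Y+ = s) = (1 + eta) / 2 and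
   P(Y- = s) = (1 - eta) / 2. Both have standard deviation sigma, |Y - E Y| stays
   between s (1 - eta) and s (1 + eta), whose ratio is at most K, and the means
   s eta and - s eta are more than 2 eps apart; so the sign of the output tests
   Y+ against Y- with both errors at most delta. By Wald's identity a test that
   uses N samples on average carries the relative entropy N kl, where
   kl = eta log ((1 + eta) / (1 - eta)) <= 2 log 3 eta^2, and this is at least
   (1 - 2 delta) log ((1 - delta) / delta). To stay with finite trees of tosses,
   the test is truncated: it rejects when more than m samples are requested, and
   m tends to infinity. *)
From HB Require Import structures.
Require Import Defs.
From mathcomp Require Import all_boot all_order all_algebra finmap.
From mathcomp Require Import all_classical all_reals all_analysis.
From mathcomp Require Import measurable_realfun ess_sup_inf.
From mathcomp Require Import bernoulli_distribution ring lra.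

Set Implicit Arguments.
Unset Strict Implicit.
Unset Printing Implicit Defensive.

Import Order.TTheory GRing.Theory Num.Theory.
Import numFieldNormedType.Exports.

Local Open Scope classical_set_scope.
Local Open Scope ring_scope.

(** * Stopped coin tossing *)

Section CoinTossing.
Context {R : realType}.
Implicit Types (p c : R) (m k : nat) (f g : seq bool -> R).

(** Expectation over [m] independent tosses, each [true] with probability [p]; one unfolding
    conditions on the first toss. *)
Fixpoint coin_mean p m f : R :=
  if m is m'.+1 then
    p * coin_mean p m' (f \o cons true) +
    (1 - p) * coin_mean p m' (f \o cons false)
  else f [::].

Lemma eq_coin_mean p m f g :
  (forall e, size e = m -> f e = g e) -> coin_mean p m f = coin_mean p m g.
Proof.
elim: m f g => [|m IH] f g fg /=; first exact: fg.
by congr (_ * _ + _ * _); apply: IH => e em /=; apply: fg; rewrite /= em.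
Qed.

Lemma coin_mean_cst p m c : coin_mean p m (fun=> c) = c.
Proof.
elim: m => [//|m IH] /=.
have e b : coin_mean p m ((fun=> c) \o cons b) = c by exact: IH.
by rewrite !e; ring.
Qed.

(** Relative entropy of the Bernoulli law with parameter [p] with respect to that with parameter
    [1 - p]. *)
Definition coin_divergence p : R :=
  p * ln (p / (1 - p)) + (1 - p) * ln ((1 - p) / p).

Lemma ln_le_subr1 c : 0 < c -> ln c <= c - 1.
Proof. by move=> c0; have := @le_ln1Dx R (c - 1); rewrite subrKC; apply; lra. Qed.

(* Gibbs' inequality for the likelihood ratio at a stopping time; letting the
   multipliers [c1] and [c2] vary makes it provable by conditioning on the first
   toss. *)
Lemma stopped_gibbs p m (c1 c2 : R) (cont : nat -> seq bool -> bool)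
    (D : seq bool -> bool) :
  0 < p < 1 -> 0 < c1 -> 0 < c2 ->
  (forall k e e', take k e = take k e' -> cont k e = cont k e') ->
  (forall k e, cont k.+1 e -> cont k e) ->
  (forall k e e', ~~ cont k e -> take k e = take k e' -> D e = D e') ->
  1 <= coin_divergence p *
         (\sum_(k < m) coin_mean p m (fun e => (cont k e)%:R))
       - ln c2 - (ln c1 - ln c2) * coin_mean p m (fun e => (D e)%:R)
       + c2 + (c1 - c2) * coin_mean (1 - p) m (fun e => (D e)%:R).
Proof.
move=> /andP[p0 p1]; set kl := coin_divergence p.
have q0 : 0 < 1 - p by lra.
elim: m c1 c2 cont D => [|m IH] c1 c2 cont D c10 c20 nonant mono detD.
  (* Without tosses the right-hand side is [c - ln c], where [c] is [c1] or [c2] according to the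
     decision. *)
  rewrite big_ord0/=.
  have := ln_le_subr1 c10; have := ln_le_subr1 c20.
  by case: (D [::]) => /=; lra.
have [cont0|ncont0] := boolP (cont 0 [::]); last first.
  (* A test that stops at once never continues and its decision is constant, so this case reduces to
     the one without tosses. *)
  have nc k e : ~~ cont k e.
    elim: k e => [|k IHk] e; first by rewrite (nonant 0 _ [::]) ?take0.
    by apply: contra (IHk e); exact: mono.
  rewrite big1 => [|k _]; last first.
    rewrite (@eq_coin_mean p _ _ (fun=> 0)) ?coin_mean_cst// => e _.
    by rewrite (negbTE (nc _ _)).
  rewrite (@eq_coin_mean p _ _ (fun=> (D [::])%:R)); last first.
    by move=> e _; rewrite (detD 0 e [::]) ?take0.
  rewrite (@eq_coin_mean (1 - p) _ _ (fun=> (D [::])%:R)); last first.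
    by move=> e _; rewrite (detD 0 e [::]) ?take0.
  rewrite !coin_mean_cst.
  have := ln_le_subr1 c10; have := ln_le_subr1 c20.
  by case: (D [::]) => /=; lra.
rewrite big_ord_recl [X in kl * (X + _)](_ : _ = 1); last first.
  rewrite (@eq_coin_mean p _ _ (fun=> 1)) ?coin_mean_cst// => e _.
  by rewrite (nonant 0 e [::]) ?take0//= cont0.
pose contb b k e := cont k.+1 (b :: e).
pose Db (b : bool) e := D (b :: e).
(* After the first toss both multipliers are scaled by [r], the likelihood ratio of that toss under
   [1 - p] against [p]. Averaging over the toss turns the terms with factor [r] into means under
   [1 - p], and the mean of [- ln r] is [kl], the price of one toss. *)
have IHb b (r : R) : 0 < r -> 1 <=
    kl * (\sum_(k < m) coin_mean p m (fun e => (contb b k e)%:R))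
    - (ln r + ln c2)
    - ((ln r + ln c1) - (ln r + ln c2)) * coin_mean p m (fun e => (Db b e)%:R)
    + r * c2 + (r * c1 - r * c2) * coin_mean (1 - p) m (fun e => (Db b e)%:R).
  move=> r0; rewrite -!lnM//.
  apply: IH; rewrite ?mulr_gt0//.
  - by move=> k e e' kee'; apply: nonant; rewrite /= kee'.
  - by move=> k e; exact: mono.
  - by move=> k e e' nc ee'; apply: detD nc _; rewrite /= ee'.
have /= IHt := IHb true _ (divr_gt0 q0 p0).
have /= IHf := IHb false _ (divr_gt0 p0 q0).
have lnpq : ln (p / (1 - p)) = - ln ((1 - p) / p) :> R.
  by rewrite -[in LHS]invf_div lnV ?posrE ?divr_gt0.
rewrite lnpq in IHf.
rewrite big_split/= -!mulr_sumr.
rewrite [in leRHS](_ : 1 - (1 - p) = p); last by ring.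
move: IHt IHf.
set S1 := \sum_(k < m) _; set S2 := \sum_(k < m) _.
set T1 := coin_mean p m _; set T2 := coin_mean p m _.
set V1 := coin_mean (1 - p) m _; set V2 := coin_mean (1 - p) m _.
have -> : kl = - (2 * p - 1) * ln ((1 - p) / p).
  by rewrite /kl /coin_divergence lnpq; ring.
set l := ln ((1 - p) / p) => IHt IHf.
have {}IHt := ler_wpM2l (ltW p0) IHt.
have {}IHf := ler_wpM2l (ltW q0) IHf.
have := lerD IHt IHf.
rewrite [X in X <= _](_ : _ = 1); last by ring.
move=> /le_trans; apply; rewrite le_eqVlt; apply/orP; left; apply/eqP; field.
by rewrite !gt_eqF.
Qed.

End CoinTossing.

(** * Logarithmic estimates *)

Section LogOdds.
Context {R : realType}.
Implicit Types x : R.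

Lemma is_derive_log_odds x : -1 < x < 1 ->
  is_derive x 1 (fun t : R => ln (1 + t) - ln (1 - t)) (2 / (1 - x ^+ 2)).
Proof.
move=> /andP[x1 x2].
have h1 : is_derive (1 + x) 1 (@ln R) ((1 + x)^-1 : R) by apply: is_derive1_ln; lra.
have h2 : is_derive (1 - x) 1 (@ln R) ((1 - x)^-1 : R) by apply: is_derive1_ln; lra.
have d1 : is_derive x (1 : R) (fun t : R => 1 + t) 1.
  have /= := is_deriveD (is_derive_cst (1 : R) x 1) (is_derive_id x 1).
  by rewrite add0r.
have d2 : is_derive x (1 : R) (fun t : R => 1 - t) (-1).
  have /= := is_deriveB (is_derive_cst (1 : R) x 1) (is_derive_id x 1).
  by rewrite sub0r.
have e1 := @is_derive1_comp _ (@ln R) (fun t : R => 1 + t) x _ _ h1 d1.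
have e2 := @is_derive1_comp _ (@ln R) (fun t : R => 1 - t) x _ _ h2 d2.
have := is_deriveB e1 e2.
rewrite (_ : _ - _ = 2 / (1 - x ^+ 2))//.
by field; apply/and3P; split; apply/eqP; nra.
Qed.

(* The left-hand side is convex in [x], and equality holds at [0] and [1/2]. *)
Lemma log_odds_le x : 0 < x <= 2^-1 ->
  ln (1 + x) - ln (1 - x) <= 2 * x * ln 3.
Proof.
move=> /andP[x0]; rewrite le_eqVlt => /predU1P[->|x12].
  rewrite -ln_div ?posrE; [|lra|lra].
  rewrite (_ : _ / _ = 3); last by field.
  by rewrite mulfV ?mul1r.
pose h := fun t : R => ln (1 + t) - ln (1 - t).
have dh (t : R) : -1 < t < 1 -> is_derive t 1 h (2 / (1 - t ^+ 2)).
  exact: is_derive_log_odds.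
have mvt (a b : R) : 0 <= a -> a < b -> b <= 2^-1 ->
    exists2 c, c \in `]a, b[ & h b - h a = (2 / (1 - c ^+ 2)) * (b - a).
  move=> a0 ab b12; apply: MVT => //.
    by move=> t /[!in_itv]/= /andP[? ?]; apply: dh; lra.
  apply: derivable_within_continuous => t /[!in_itv]/= /andP[? ?].
  have t1 : -1 < t < 1 by lra.
  by have [] := dh t t1.
(* Convexity enters through the slopes of [h] on [[0, x]] and on [[x, 1/2]]: the derivative
   increases, so the first is at most the second. *)
have [c1 /[!in_itv]/= /andP[c10 c1x]] := mvt 0 x (lexx _) x0 (ltW x12).
have [c2 /[!in_itv]/= /andP[c20 c2x]] := mvt x 2^-1 (ltW x0) x12 (lexx _).
have -> : h 0 = 0 by rewrite /h addr0 subr0 subrr.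
have -> : h 2^-1 = ln 3.
  rewrite /h -ln_div ?posrE; [|lra|lra].
  by congr ln; field.
rewrite -/(h x).
have : 2 / (1 - c1 ^+ 2) <= 2 / (1 - c2 ^+ 2).
  by rewrite ler_pM2l// lef_pV2 ?posrE; nra.
move: (2 / _) (2 / _) => v u uv h2; rewrite subr0 => h1.
(* This product is the difference of the two sides once [h x] and [ln 3] are expressed through the
   slopes [u] and [v]. *)
have : 0 <= x * ((v - u) * (1 - 2 * x)) by rewrite !mulr_ge0//; lra.
nra.
Qed.

(** The parameters [p] and [1 - p] differ by [x], so the divergence is
    [x * (ln (1 + x) - ln (1 - x))]. *)
Lemma coin_divergence_le x : 0 < x <= 2^-1 ->
  coin_divergence ((1 + x) / 2) <= 2 * ln 3 * x ^+ 2.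
Proof.
move=> /andP[x0 x1].
have := @log_odds_le x; rewrite x0 x1 => /(_ isT).
rewrite /coin_divergence.
have -> : (1 + x) / 2 / (1 - (1 + x) / 2) = (1 + x) / (1 - x).
  by field; rewrite ?gt_eqF//=; lra.
have -> : (1 - (1 + x) / 2) / ((1 + x) / 2) = (1 - x) / (1 + x).
  by field; rewrite ?gt_eqF//=; lra.
rewrite !ln_div ?posrE; try lra.
move: (ln (1 + x)) (ln (1 - x)) (ln 3) => a b l h.
by nra.
Qed.

(* The right-hand side is the relative entropy of the Bernoulli laws with
   parameters [1 - delta] and [delta]. *)
Lemma binary_divergence_ge (delta : R) : 0 < delta <= 1 / 4 ->
  ln ((4 / 3 * delta)^-1) / 2 <= (1 - 2 * delta) * ln ((1 - delta) / delta).
Proof.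
move=> /andP[d0 d1].
(* The constant [4 / 3] comes from [1 - delta >= 3 / 4]; the division by [2] comes from
   [1 - 2 * delta >= 1 / 2]. *)
have h : (4 / 3 * delta)^-1 <= (1 - delta) / delta.
  rewrite invfM mulrC (mulrC (1 - _)) ler_pM2l ?invr_gt0//; lra.
have p0 : 0 < (4 / 3 * delta)^-1 by rewrite invr_gt0; lra.
have : ln ((4 / 3 * delta)^-1) <= ln ((1 - delta) / delta).
  by rewrite ler_ln ?posrE//; exact: lt_le_trans h.
have : 0 <= ln ((4 / 3 * delta)^-1) by rewrite ln_ge0// invf_ge1; lra.
by nra.
Qed.

End LogOdds.

(** * Samples from a two-point law *)

Section RealSeqMeasurability.
Context {R : realType}.

Lemma measurable_real_seq d (T : measurableType d) (f : T -> real_seq R) :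
  (forall i, measurable_fun [set: T] (fun w => f w i)) ->
  measurable_fun [set: T] f.
Proof.
move=> mf; apply: (@measurability _ _ _ _ _ f (@coordinate_sets R)) => //.
move=> _ [_ [i _ [B mB <-]] <-].
by have := mf i measurableT _ mB; rewrite !setTI.
Qed.

Lemma measurable_coordinate i :
  measurable_fun [set: real_seq R] (fun y : real_seq R => y i).
Proof.
move=> _ B mB; apply: sub_sigma_algebra; exists i => //.
by exists B.
Qed.

Lemma measurable_keep_first (m : option nat) :
  measurable_fun [set: real_seq R] (keep_first m : real_seq R -> real_seq R).
Proof.
apply: measurable_real_seq => i; rewrite /keep_first.
case: m => [k|]; last exact: measurable_coordinate.
by case: (i < k)%N; [exact: measurable_coordinate|exact: measurable_cst].
Qed.

End RealSeqMeasurability.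

Section TwoPointSample.
Context d (T : measurableType d) (R : realType) (P : probability T R).

(** Laws determine the values of a sample only up to a null event; this permits a case distinction
    on the two outcomes all the same. *)
Lemma two_event_split (A E F : set T) :
  measurable A -> measurable E -> measurable F -> E `&` F = set0 ->
  (P E + P F = 1)%E -> (P A = P (A `&` E) + P (A `&` F))%E.
Proof.
move=> mA mE mF EF0 PEF.
have mEF : measurable (E `|` F) by exact: measurableU.
have PC : P (~` (E `|` F)) = 0%E.
  by rewrite probability_setC// measureU// PEF subee.
have PN : P (A `\` (E `|` F)) = 0%E.
  apply: subset_measure0 PC; [exact: measurableD|exact: measurableC|].
  by move=> x [].
have PA : P A = (P (A `\` (E `|` F)) + P (A `&` (E `|` F)))%E.
  exact: measureDI.
rewrite PA PN add0e setIUr measureU//; try exact: measurableI.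
by rewrite setIACA EF0 setI0.
Qed.

Context d' (T' : measurableType d') (U : {RV P >-> T'})
  (Ys : nat -> {RV P >-> R}) (v : bool -> R) (p : R).
Hypothesis indep : mutually_independent P (generated_sigma U Ys).
Hypothesis lawT : forall i, P (Ys i @^-1` [set v true]) = p%:E.
Hypothesis lawF : forall i, P (Ys i @^-1` [set v false]) = (1 - p)%:E.
Hypothesis v_neq : v true <> v false.

Let weight (e : seq bool) : R := \prod_(b <- e) (if b then p else 1 - p).

(** Entries past the tosses are [0]; events decided by the first [size e] entries do not see
    them. *)
Definition toss_values (e : seq bool) : real_seq R := fun i => nth 0 (map v e) i.

Let prefix_event (e : seq bool) : set T :=
  [set w | forall i, (i < size e)%N -> Ys i w = v (nth true e i)].

Let measurable_prefix_event e : measurable (prefix_event e).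
Proof.
have -> : prefix_event e =
    \bigcap_(i < size e) (Ys i @^-1` [set v (nth true e i)]) by [].
by rewrite bigcap_mkord; apply: bigsetI_measurable => i _; exact: measurable_funPTI.
Qed.

Let prefix_event_indep e (S : set T') : measurable S ->
  P (U @^-1` S `&` prefix_event e) = (weight e * fine (P (U @^-1` S)))%:E.
Proof.
move=> mS.
pose s := None :: [seq Some i | i <- iota 0 (size e)].
have us : uniq s.
  rewrite /= map_inj_uniq ?iota_uniq ?andbT; last by move=> ? ? [].
  by apply/mapP => -[].
pose E (o : option nat) : set T :=
  if o is Some i then Ys i @^-1` [set v (nth true e i)] else U @^-1` S.
have := @indep [fset x in s]%fset E; rewrite (_ : \bigcap_(i in _) _ =
    U @^-1` S `&` prefix_event e); last first.
  apply/seteqP; split=> w.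
    move=> h; split; first by apply: (h None); rewrite /= !inE.
    move=> i ie; apply: (h (Some i)); rewrite /= !inE/=.
    by rewrite mem_map ?mem_iota// => ? ? [].
  move=> [hU hY] [i|] //=; rewrite !inE/= mem_map ?mem_iota => [|? ? []//].
  exact: hY.
move=> ->; last first.
  move=> [i|] _ /=.
    by exists [set v (nth true e i)] => //; rewrite setTI.
  by exists S => //; rewrite setTI.
rewrite (perm_big s)/=; last first.
  by apply: uniq_perm => [||o]; rewrite ?fset_uniq// !inE.
rewrite /s big_cons big_map /=.
rewrite [X in (_ * X)%E](_ : _ = (weight e)%:E); last first.
  rewrite /weight (big_nth true) -prodEFin /index_iota subn0.
  by apply: eq_bigr => i _; case: (nth true e i); rewrite ?lawT ?lawF.
rewrite mulrC EFinM fineK// fin_num_measure//.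
exact: measurable_funPTI.
Qed.

Lemma measurable_sample_event (B : set (T' * real_seq R)) : measurable B ->
  measurable [set w | B (U w, (fun i => Ys i w) : real_seq R)].
Proof.
move=> mB; rewrite -[X in measurable X]setTI.
have mUY : measurable_fun [set: T] (fun w => (U w, (fun i => Ys i w) : real_seq R)).
  apply: measurable_fun_pair; first exact: measurable_funP.
  by apply: measurable_real_seq => i; exact: measurable_funP.
exact: mUY.
Qed.

Lemma measurable_section_event (B : set (T' * real_seq R)) (y : real_seq R) :
  measurable B -> measurable [set w | B (U w, y)].
Proof.
move=> mB; rewrite -[X in measurable X]setTI.
have mUy : measurable_fun [set: T] (fun w => (U w, y)).
  by apply: measurable_fun_pair; [exact: measurable_funP|exact: measurable_cst].
exact: mUy.
Qed.

(** Induction on the number [m] of samples still to be revealed after the prefix [e]: for [m = 0]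
    the event depends on [U] and [e] alone and independence applies; otherwise the next sample
    splits it in two. *)
Let sample_law_prefix m e (B : set (T' * real_seq R)) : measurable B ->
  (forall u y y', (forall j, (j < size e + m)%N -> y j = y' j) ->
    B (u, y) -> B (u, y')) ->
  P ([set w | B (U w, (fun i => Ys i w) : real_seq R)] `&` prefix_event e) =
  (weight e *
    coin_mean p m (fun e' => fine (P [set w | B (U w, toss_values (e ++ e'))])))%:E.
Proof.
move=> mB; elim: m e => [|m IH] e detB.
  rewrite addn0 in detB; rewrite /= cats0.
  have mS : measurable [set u | B (u, toss_values e)].
    rewrite -[X in measurable X]setTI.
    have mid : measurable_fun [set: T'] (fun u => (u, toss_values e)).
      by apply: measurable_fun_pair; [exact: measurable_id|exact: measurable_cst].
    exact: mid.
  rewrite -(prefix_event_indep e mS); congr (P _).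
  have vE w j : prefix_event e w -> (j < size e)%N -> Ys j w = toss_values e j.
    by move=> we je; rewrite we// /toss_values (nth_map true).
  apply/seteqP; split=> w [/= Bw we]; split => //=; apply: detB Bw => j je.
    exact: vE.
  by rewrite -(vE w).
pose Z b := Ys (size e) @^-1` [set v b].
have mZ b : measurable (Z b) by exact: measurable_funPTI.
have ZZ : Z true `&` Z false = set0.
  by apply/seteqP; split=> // w [Zt Zf]; apply: v_neq; rewrite -Zt -Zf.
rewrite (@two_event_split _ (Z true) (Z false))//; last 2 first.
- by apply: measurableI; [exact: measurable_sample_event|].
- by rewrite /Z lawT lawF -EFinD; congr EFin; ring.
have prefixE b : prefix_event e `&` Z b = prefix_event (rcons e b).
  apply/seteqP; split=> w.
    move=> [we wb] i; rewrite size_rcons ltnS leq_eqVlt => /predU1P[->|ie].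
      by rewrite nth_rcons ltnn eqxx.
    by rewrite nth_rcons ie; exact: we.
  move=> h; split.
    move=> i ie; have := h i; rewrite size_rcons nth_rcons ie; apply.
    exact: leqW.
  by have := h (size e); rewrite size_rcons nth_rcons ltnn eqxx; apply.
rewrite -!setIA !prefixE !IH; last 2 first.
- by move=> u y y' yy'; apply: detB => j jm; apply: yy'; rewrite size_rcons addSnnS.
- by move=> u y y' yy'; apply: detB => j jm; apply: yy'; rewrite size_rcons addSnnS.
rewrite -EFinD; congr EFin => /=.
have coinE b : coin_mean p m
      (fun e' => fine (P [set w | B (U w, toss_values (rcons e b ++ e'))])) =
    coin_mean p m
      (fun e' => fine (P [set w | B (U w, toss_values (e ++ b :: e'))])).
  by apply: eq_coin_mean => e' _; rewrite cat_rcons.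
by rewrite !coinE /weight -!cats1 !big_cat !big_seq1/= /comp; ring.
Qed.

(** Integrates out the sample: only the randomness of [U] remains inside the finite mean over toss
    sequences. *)
Lemma sample_law m (B : set (T' * real_seq R)) : measurable B ->
  (forall u y y', (forall j, (j < m)%N -> y j = y' j) ->
    B (u, y) -> B (u, y')) ->
  fine (P [set w | B (U w, (fun i => Ys i w) : real_seq R)]) =
  coin_mean p m (fun e => fine (P [set w | B (U w, toss_values e)])).
Proof.
move=> mB detB; have := @sample_law_prefix m [::] B mB detB.
rewrite /weight big_nil mul1r (_ : prefix_event [::] = setT).
  by rewrite setIT => ->.
by apply/seteqP; split.
Qed.

End TwoPointSample.

(** * Linearity of the mean *)

Section HasMean.
Context d (T : measurableType d) (R : realType) (P : probability T R).
Implicit Types (f g : T -> R) (a b c : R).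

Definition has_mean f a :=
  P.-integrable setT (EFin \o f) /\ Rintegral P setT f = a.

Lemma has_mean_cst c : has_mean (cst c) c.
Proof.
split; first exact: finite_measure_integrable_cst.
by rewrite Rintegral_cst//= probability_setT mulr1.
Qed.

Lemma has_meanD f g a b :
  has_mean f a -> has_mean g b -> has_mean (fun w => f w + g w) (a + b).
Proof.
move=> [fi <-] [gi <-]; split; last by rewrite RintegralD.
exact: (integrableD measurableT fi gi).
Qed.

Lemma has_meanZ c f a : has_mean f a -> has_mean (fun w => c * f w) (c * a).
Proof.
move=> [fi <-]; split; last by rewrite RintegralZl.
exact: (integrableZl measurableT c fi).
Qed.

Lemma has_mean_sum m (f : nat -> T -> R) (a : nat -> R) :
  (forall k, has_mean (f k) (a k)) ->
  has_mean (fun w => \sum_(k < m) f k w) (\sum_(k < m) a k).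
Proof.
move=> fa; elim: m => [|m IH].
  rewrite big_ord0; rewrite [X in has_mean X](_ : _ = cst 0).
    exact: has_mean_cst.
  by apply/funext => w; rewrite big_ord0.
rewrite big_ord_recr/= [X in has_mean X](_ : _ =
    fun w => \sum_(k < m) f k w + f m w); first exact: has_meanD.
by apply/funext => w; rewrite big_ord_recr.
Qed.

Lemma le_has_mean f g a b : (forall w, f w <= g w) ->
  has_mean f a -> has_mean g b -> a <= b.
Proof. by move=> fg [fi <-] [gi <-]; apply: le_Rintegral. Qed.

(** A mean over finitely many tosses is a finite linear combination, hence commutes with the
    expectation over the auxiliary randomness. *)
Lemma has_mean_coin_mean p m (S : seq bool -> set T) :
  (forall e, measurable (S e)) ->
  has_mean (fun w => coin_mean p m (fun e => `[< S e w >]%:R))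
    (coin_mean p m (fun e => fine (P (S e)))).
Proof.
elim: m S => [|m IH] S mS /=.
  have -> : (fun w => `[< S [::] w >]%:R) = \1_(S [::]) :> (T -> R) by [].
  split; first exact: integrable_indic.
  by rewrite /Rintegral integral_indic// setIT.
apply: has_meanD; apply: has_meanZ.
- exact: (IH (S \o cons true) (fun e => mS _)).
- exact: (IH (S \o cons false) (fun e => mS _)).
Qed.

End HasMean.

(** * Randomized sequential tests between two mirrored two-point laws *)

Section StoppedTwoPointTest.
Context d (T : measurableType d) (R : realType) (P : probability T R).
Context d' (T' : measurableType d') (U : {RV P >-> T'}).
Variables (m : nat) (cont : nat -> set (T' * real_seq R))
  (D : set (T' * real_seq R)).
Hypothesis mcont : forall k, measurable (cont k).
Hypothesis mD : measurable D.
Hypothesis cont_dep : forall k u y y', (forall j, (j < k)%N -> y j = y' j) ->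
  cont k (u, y) -> cont k (u, y').
Hypothesis cont_mono : forall k x, cont k.+1 x -> cont k x.
Hypothesis D_dep : forall k u y y', ~ cont k (u, y) ->
  (forall j, (j < k)%N -> y j = y' j) -> D (u, y) -> D (u, y').
Hypothesis D_stopped : forall x, D x -> ~ cont m x.

Let run_in (B : set (T' * real_seq R)) (Ys : nat -> {RV P >-> R}) :=
  [set w | B (U w, (fun i => Ys i w) : real_seq R)].

(** Once the value of [U] is fixed, the test is a deterministic function of the tosses and
    [stopped_gibbs] applies. All its terms are linear in the indicators, so the inequality survives
    averaging over [U]. *)
Lemma stopped_two_point_test (Y1 Y2 : nat -> {RV P >-> R}) (v : bool -> R)
    (p c1 c2 : R) :
  mutually_independent P (generated_sigma U Y1) ->
  mutually_independent P (generated_sigma U Y2) ->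
  (forall i, P (Y1 i @^-1` [set v true]) = p%:E) ->
  (forall i, P (Y1 i @^-1` [set v false]) = (1 - p)%:E) ->
  (forall i, P (Y2 i @^-1` [set v true]) = (1 - p)%:E) ->
  (forall i, P (Y2 i @^-1` [set v false]) = p%:E) ->
  v true <> v false -> 0 < p < 1 -> 0 < c1 -> 0 < c2 ->
  1 <= coin_divergence p * (\sum_(k < m) fine (P (run_in (cont k) Y1)))
       - ln c2 - (ln c1 - ln c2) * fine (P (run_in D Y1))
       + c2 + (c1 - c2) * fine (P (run_in D Y2)).
Proof.
move=> ind1 ind2 l1t l1f l2t l2f v_neq p01 c10 c20.
have l2f' i : P (Y2 i @^-1` [set v false]) = (1 - (1 - p))%:E.
  by rewrite l2f; congr EFin; ring.
(* Points of [D] have stopped by time [m], so membership is decided by the first [m] entries. *)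
have D_depm u y y' : (forall j, (j < m)%N -> y j = y' j) -> D (u, y) -> D (u, y').
  by by move=> yy' Duy; apply: (D_dep _ yy' Duy); exact: D_stopped.
rewrite /run_in.
rewrite (sample_law ind1 l1t l1f v_neq mD D_depm).
rewrite (sample_law ind2 l2t l2f' v_neq mD D_depm).
under eq_bigr => k _.
  rewrite (sample_law (m := m) ind1 l1t l1f v_neq (mcont k)); last first.
    by move=> u y y' yy'; apply: cont_dep => j jk; apply: yy'; exact: ltn_trans (ltn_ord k).
  over.
pose C k e := [set w | cont k (U w, toss_values v e)].
pose D' e := [set w | D (U w, toss_values v e)].
have mC k e : measurable (C k e) by exact: measurable_section_event.
have mD' e : measurable (D' e) by exact: measurable_section_event.
apply: (@le_has_mean _ _ _ P (cst 1) (fun w =>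
  coin_divergence p *
    (\sum_(k < m) coin_mean p m (fun e => `[< C k e w >]%:R))
    + (- ln c2 + (- (ln c1 - ln c2) * coin_mean p m (fun e => `[< D' e w >]%:R)
    + (c2 + (c1 - c2) * coin_mean (1 - p) m (fun e => `[< D' e w >]%:R))))));
  last 2 first.
- exact: has_mean_cst.
- rewrite -!addrA -mulNr; apply: has_meanD.
    apply: has_meanZ; apply: (@has_mean_sum _ _ _ P m (fun k w =>
       coin_mean p m (fun e => `[< C k e w >]%:R))
       (fun k => coin_mean p m (fun e => fine (P (C k e))))) => k.
    exact: has_mean_coin_mean.
  apply: has_meanD; first exact: has_mean_cst.
  apply: has_meanD; first exact/has_meanZ/has_mean_coin_mean.
  apply: has_meanD; first exact: has_mean_cst.
  exact/has_meanZ/has_mean_coin_mean.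
move=> w /=.
have toss_valuesE k e e' : take k e = take k e' ->
    forall j, (j < k)%N -> toss_values v e j = toss_values v e' j.
  move=> ee' j jk; rewrite /toss_values -(nth_take _ jk) -[RHS](nth_take _ jk).
  by rewrite -!map_take ee'.
have contE k e e' : take k e = take k e' -> `[< C k e w >] = `[< C k e' w >].
  move=> ee'; apply/asbool_equiv_eq; split; apply: cont_dep; exact: toss_valuesE.
have := @stopped_gibbs R p m c1 c2 (fun k e => `[< C k e w >])
  (fun e => `[< D' e w >]) p01 c10 c20 contE.
rewrite -!addrA mulNr; apply.
- by move=> k e /asboolP h; apply/asboolP; exact: cont_mono h.
- move=> k e e' nC ee'; have nC' : ~~ `[< C k e' w >] by rewrite -(contE _ _ _ ee').
  move/asboolPn : nC => nC; move/asboolPn : nC' => nC'.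
  apply/asbool_equiv_eq; split.
    exact: (D_dep nC (toss_valuesE _ _ _ ee')).
  exact: (D_dep nC' (toss_valuesE _ _ _ (esym ee'))).
Qed.

End StoppedTwoPointTest.

(** * Two-point variables in the class *)

Section LnormBounds.
Context d (T : measurableType d) (R : realType) (P : probability T R).
Implicit Types (f : T -> R) (a r : R) (q : \bar R).

Let measurable_norm_powR f r : measurable_fun setT f ->
  measurable_fun setT (fun w => (`|f w| `^ r)%:E).
Proof.
move=> mf; apply/measurable_EFinP; apply: (measurableT_comp (measurable_powR r)).
exact: measurableT_comp.
Qed.

Lemma Lnorm_le_bound q f a : measurable_fun setT f -> (1 <= q)%E ->
  (forall w, `|f w| <= a) -> ('N[P]_q[EFin \o f] <= a%:E)%E.
Proof.
move=> mf q1 fa.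
have a0 : 0 <= a by exact: le_trans (normr_ge0 _) (fa point).
case: q q1 => [r| |]//; rewrite unlock.
  rewrite lee_fin => r1; have r0 : 0 < r by exact: lt_le_trans r1.
  have -> : a%:E = ((a `^ r)%:E `^ r^-1)%E.
    by rewrite poweR_EFin -powRrM divff ?gt_eqF// powRr1.
  apply: gt0_ler_poweR.
  - by rewrite invr_ge0 ltW.
  - by rewrite in_itv/= leey andbT integral_ge0.
  - by rewrite in_itv/= leey andbT lee_fin powR_ge0.
  rewrite -[leRHS]mule1 -(probability_setT P) -integral_cst//.
  apply: ge0_le_integral => //=.
  - exact: measurable_norm_powR.
  - by move=> w _; rewrite lee_fin ge0_ler_powR ?nnegrE// ltW.
move=> _; case: ifP => _; last by rewrite lee_fin.
by apply/ess_supP/nearW => w; rewrite lee_fin.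
Qed.

Lemma Lnorm_ge_bound r f a : measurable_fun setT f -> 1 <= r -> 0 <= a ->
  (forall w, a <= `|f w|) -> (a%:E <= 'N[P]_r%:E[EFin \o f])%E.
Proof.
move=> mf r1 a0 fa; rewrite unlock.
have r0 : 0 < r by exact: lt_le_trans r1.
have -> : a%:E = ((a `^ r)%:E `^ r^-1)%E.
  by rewrite poweR_EFin -powRrM divff ?gt_eqF// powRr1.
apply: gt0_ler_poweR.
- by rewrite invr_ge0 ltW.
- by rewrite in_itv/= leey andbT lee_fin powR_ge0.
- by rewrite in_itv/= leey andbT integral_ge0.
rewrite -[leLHS]mule1 -(probability_setT P) -integral_cst//.
apply: ge0_le_integral => //=.
- by move=> _ _; rewrite lee_fin powR_ge0.
- exact: measurable_norm_powR.
- by move=> w _; rewrite lee_fin ge0_ler_powR ?nnegrE// ltW.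
Qed.

End LnormBounds.

Section SymmetricTwoPoint.
Context d (T : measurableType d) (R : realType) (P : probability T R).

(** The Bernoulli law, pushed to the reals, is the law of some variable on the space; the event is
    where that variable equals [1]. *)
Lemma rich_event (p : R) : rich P -> 0 <= p <= 1 ->
  exists2 S : set T, measurable S & P S = p%:E.
Proof.
move=> hP p01.
pose b2R (b : bool) : measurableTypeR R := b%:R.
have mX : measurable_fun [set: bool] b2R by [].
pose X : {mfun bool >-> measurableTypeR R} :=
  HB.pack b2R (isMeasurableFun.Build _ _ _ _ _ mX).
pose mu : probability (measurableTypeR R) R :=
  distribution (bernoulli_prob p : probability bool R) X.
have [Z ZX] := hP mu.
exists (Z @^-1` [set 1]); first exact: measurable_funPTI.
have -> : P (Z @^-1` [set 1]) = distribution P Z [set 1] by [].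
rewrite ZX//; transitivity (bernoulli_prob p (X @^-1` [set 1])) => //.
rewrite bernoulli_probE//.
rewrite !diracE mem_set ?memNset//=; first by rewrite mule1 mule0 adde0.
by move/eqP; rewrite eq_sym oner_eq0.
Qed.

(** Built from an indicator, so that the values are [s] and [- s] everywhere and pointwise bounds on
    the centered variable are available. *)
Lemma rich_two_point (s p : R) : rich P -> 0 < s -> 0 <= p <= 1 ->
  exists Y : {RV P >-> R}, [/\ (forall w, Y w = s \/ Y w = - s),
    P (Y @^-1` [set s]) = p%:E, P (Y @^-1` [set - s]) = (1 - p)%:E &
    has_mean P Y (s * (2 * p - 1))].
Proof.
move=> hP s0 p01; have [S mS PS] := rich_event hP p01.
pose f w : R := - s + (2 * s) * \1_S w.
have mf : measurable_fun setT f.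
  apply: measurable_funD => //; apply: measurable_funM => //.
pose Y : {RV P >-> R} := HB.pack f (isMeasurableFun.Build _ _ _ _ _ mf).
have fS w : S w -> f w = s.
  by move=> Sw; rewrite /f indicE mem_set//=; ring.
have fNS w : ~ S w -> f w = - s.
  by move=> Sw; rewrite /f indicE memNset//=; ring.
have sNs : s <> - s by lra.
exists Y; split.
- by move=> w; have [Sw|Sw] := pselect (S w); [left; exact: fS|right; exact: fNS].
- rewrite -PS; congr (P _); apply/seteqP; split=> w; last exact: fS.
  by move=> /= fw; apply: contrapT => /fNS; rewrite fw => /sNs.
- rewrite EFinB -PS -probability_setC//; congr (P _).
  apply/seteqP; split=> w; last exact: fNS.
  by move=> /= fw /fS; rewrite fw => /esym/sNs.
- rewrite (_ : s * _ = - s + (2 * s) * p); last by ring.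
  apply: has_meanD; first exact: has_mean_cst.
  apply: has_meanZ; split; first exact: integrable_indic.
  by rewrite /Rintegral integral_indic// setIT -[RHS]/(fine p%:E) -PS.
Qed.

Lemma has_mean_expectation (Y : {RV P >-> R}) a :
  has_mean P Y a -> fine 'E_P[Y]%E = a.
Proof. by move=> [_ <-]; rewrite expectation_def. Qed.

(** Norms of every order lie between the extremes of [|Y - mu|], so a single ratio bound serves all
    [p] and [q]. *)
Lemma two_point_in_class (Y : {RV P >-> R}) (p q : \bar R) (K sigma s mu : R) :
  (1 <= p)%E -> (p < q)%E -> 0 < s -> `|mu| < s ->
  s + `|mu| <= K * (s - `|mu|) -> s ^+ 2 - mu ^+ 2 = sigma ^+ 2 -> 0 < sigma ->
  (forall w, Y w = s \/ Y w = - s) -> has_mean P Y mu ->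
  (class_Y P p q K `&` sigma_ball2 P sigma) Y.
Proof.
move=> p1 pq s0 mus hK hsig sig0 Yval Ymean.
have EY := has_mean_expectation Ymean.
have mY : measurable_fun setT Y by exact: measurable_funP.
have q1 : (1 <= q)%E by exact: le_trans p1 (ltW pq).
have Ys w : `|Y w| <= s by case: (Yval w) => ->; rewrite ?normrN ger0_norm// ltW.
have YLfun r : (1 <= r)%E -> (Y : T -> R) \in Lfun P r.
  move=> r1; rewrite inE/=; apply/andP; split; rewrite inE//=.
  by apply: le_lt_trans (Lnorm_le_bound P mY r1 Ys) (ltry _).
have mc : measurable_fun setT (centered Y).
  by apply: measurable_funB => //; exact: measurable_cst.
have cle w : `|centered Y w| <= s + `|mu|.
  by rewrite /centered EY (le_trans (ler_normB _ _))// lerD2r.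
have cge w : s - `|mu| <= `|centered Y w|.
  rewrite /centered EY (le_trans _ (lerB_dist _ _))// lerD2r.
  by case: (Yval w) => ->; rewrite ?normrN ger0_norm// ltW.
split; split.
- exact: YLfun.
- apply: (le_trans (Lnorm_le_bound P mc q1 cle)).
  case: p p1 pq => [r| |]//; last by move=> _; rewrite ltNge leey.
  rewrite lee_fin => r1 _.
  have t0 : 0 < s - `|mu| by rewrite subr_gt0.
  have K0 : 0 <= K.
    rewrite -(pmulr_lge0 _ t0); apply: le_trans hK.
    by rewrite addr_ge0 ?normr_ge0// ltW.
  apply: le_trans (lee_wpmul2l _ (Lnorm_ge_bound P mc r1 (ltW t0) cge)).
    by rewrite -EFinM lee_fin.
  by rewrite lee_fin.
- by apply: YLfun; rewrite lee_fin; lra.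
- have : has_mean P (fun w => `|centered Y w| `^ 2) (sigma ^+ 2).
    (* Since [Y ^+ 2 = s ^+ 2], the squared deviation is affine in [Y], and its mean follows by
       linearity. *)
    rewrite (_ : (fun w => _) = (fun w => (s ^+ 2 + mu ^+ 2) + (- (2 * mu)) * Y w)).
      rewrite (_ : sigma ^+ 2 = (s ^+ 2 + mu ^+ 2) + (- (2 * mu)) * mu); last first.
        by rewrite -hsig; ring.
      apply: has_meanD; first exact: has_mean_cst.
      exact: has_meanZ.
    apply/funext => w; rewrite powR_mulrn// -normrX ger0_norm ?sqr_ge0//.
    by rewrite /centered EY; case: (Yval w) => ->; ring.
  move=> [ci cE]; rewrite unlock.
  rewrite (_ : (\int[P]_x _)%E = (sigma ^+ 2)%:E); last first.
    by rewrite -cE /Rintegral fineK//; exact: integrable_fin_num.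
  rewrite poweR_EFin lee_fin -(@powR_mulrn _ sigma 2 (ltW sig0)).
  by rewrite -powRrM divff// (powRr1 (ltW sig0)).
Qed.

End SymmetricTwoPoint.

(** * Algorithms on two-point inputs *)

Lemma enat_eq_Some k (o : option nat) :
  enat_ge k o -> ~~ enat_ge k.+1 o -> o = Some k.
Proof.
case: o => [j|]//= kj; rewrite -ltnNge ltnS => jk.
by congr Some; apply/eqP; rewrite eqn_leq jk.
Qed.

(** The sum counts the samples taken among the first [m], that is, the minimum of [m] and the
    stopping time. *)
Lemma sum_enat_ge (R : realType) m (o : option nat) :
  ((\sum_(k < m) (enat_ge k.+1 o)%:R)%:E <= enat_val R o)%E.
Proof.
case: o => [j|] /=; last exact: leey.
rewrite lee_fin -natr_sum ler_nat.
elim: m => [|m IH]; first by rewrite big_ord0.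
rewrite big_ord_recr/=; case: (ltnP m j) => mj; last by rewrite addn0.
apply: leq_trans mj; rewrite addn1 ltnS -[leqRHS]card_ord -sum1_card.
by apply: leq_sum => k _; exact: leq_b1.
Qed.

Section AlgorithmOnTwoPointInputs.
Context d (T : measurableType d) (R : realType) (P : probability T R).
Variables (C : set {RV P >-> R}) (A : iid_algorithm C).

Definition stop_rule : aux_space A * real_seq R -> option nat := @stop _ _ _ _ _ A.

(** More than [k] samples are taken; by nonanticipation this is decided by the entries with index
    below [k]. *)
Definition continues k : set (aux_space A * real_seq R) :=
  [set x | enat_ge k.+1 (stop_rule x)].

Definition accepts k : set (aux_space A * real_seq R) :=
  [set x | stop_rule x = Some k /\ 0 < phi A (x.1, keep_first (Some k) x.2)].

(** Acceptance region of the truncated test: a run that requests more than [m] samples counts as a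
    rejection. *)
Definition accepts_by m : set (aux_space A * real_seq R) :=
  \bigcup_(k in [set k | (k <= m)%N]) accepts k.

Let measurable_continues k : measurable (continues k).
Proof. exact: (@stop_measurable _ _ _ _ _ A [set o | enat_ge k.+1 o]). Qed.

Let measurable_truncated_phi (o : option nat) :
  measurable_fun setT (fun x : aux_space A * real_seq R =>
    phi A (x.1, keep_first o x.2)).
Proof.
apply: (measurableT_comp (measurable_funP (phi A))).
apply: measurable_fun_pair; first exact: measurable_fst.
by apply: (measurableT_comp (measurable_keep_first o)); exact: measurable_snd.
Qed.

Let measurable_accepts_by m : measurable (accepts_by m).
Proof.
apply: bigcup_measurable => k _; apply: measurableI.
  exact: (@stop_measurable _ _ _ _ _ A [set Some k]).
have := measurable_truncated_phi (Some k) measurableT (measurable_itv `]0, +oo[).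
rewrite setTI; congr (measurable _).
by apply/seteqP; split => x /=; rewrite in_itv/= andbT.
Qed.

(** Stopping at [k] means reaching [k] but not [k.+1], and both events are decided by the first [k]
    entries. *)
Let stop_dep k u y y' : (forall j, (j < k)%N -> y j = y' j) ->
  stop_rule (u, y) = Some k -> stop_rule (u, y') = Some k.
Proof.
rewrite /stop_rule => yy' sk; apply: enat_eq_Some.
  rewrite -(@stop_nonanticipating _ _ _ _ _ A k u y y') ?sk//= => j jk.
  by apply: yy'; exact: ltnW.
by rewrite -(@stop_nonanticipating _ _ _ _ _ A k.+1 u y y') ?sk/= ?ltnn.
Qed.

Let accepts_dep m k u y y' : ~ continues k (u, y) ->
  (forall j, (j < k)%N -> y j = y' j) ->
  accepts_by m (u, y) -> accepts_by m (u, y').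
Proof.
move=> nk yy' [i im [si pi]].
have ik : (i <= k)%N.
  by rewrite leqNgt; apply/negP => ki; apply: nk; rewrite /continues/= si.
have yyi j : (j < i)%N -> y j = y' j by move=> ji; apply: yy'; exact: leq_trans ik.
exists i => //; split; first exact: stop_dep si.
rewrite (_ : keep_first _ _ = keep_first (Some i) y)//.
by apply/funext => j /=; case: ltnP => // /yyi ->.
Qed.

Definition sample Y (w : T) : aux_space A * real_seq R :=
  (aux A w, (fun i => copies A Y i w)).

Let measurable_sample Y : measurable_fun setT (sample Y).
Proof.
apply: measurable_fun_pair; first exact: measurable_funP.
by apply: measurable_real_seq => i; exact: measurable_funP.
Qed.

Let measurable_run_length Y (O : set (option nat)) :
  measurable [set w | O (run_length A Y w)].
Proof.
rewrite -[X in measurable X]setTI.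
exact: (measurable_sample Y measurableT (@stop_measurable _ _ _ _ _ A O)).
Qed.

(** The stopping time has countably many values, and on each of them the truncation of the input is
    a fixed measurable map. *)
Lemma measurable_run_output Y : measurable_fun setT (run_output A Y).
Proof.
move=> _ B mB; rewrite setTI.
rewrite (_ : _ @^-1` _ = \bigcup_(o in [set: option nat])
   ([set w | run_length A Y w = o] `&`
    [set w | B (phi A (aux A w, keep_first o (fun i => copies A Y i w)))])).
  apply: countable_bigcupT_measurable => //= o; apply: measurableI.
    exact: (measurable_run_length Y [set o]).
  have := measurableT_comp (measurable_truncated_phi o) (measurable_sample Y).
  by move=> /(_ measurableT _ mB); rewrite setTI.
apply/seteqP; split => w /=.
  by move=> Bw; exists (run_length A Y w).
by move=> [r _ [ro Bw]]; rewrite /run_output ro.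
Qed.

Definition prob_continues Y k : R := fine (P [set w | continues k (sample Y w)]).
Definition prob_accepts Y m : R := fine (P [set w | accepts_by m (sample Y w)]).

Lemma sum_prob_continues Y m :
  ((\sum_(k < m) prob_continues Y k)%:E <= expected_cost A Y)%E.
Proof.
pose f w : R := \sum_(k < m) (enat_ge k.+1 (run_length A Y w))%:R.
have [fi <-] : has_mean P f (\sum_(k < m) prob_continues Y k).
  apply: (@has_mean_sum _ _ _ P m
    (fun k w => (enat_ge k.+1 (run_length A Y w))%:R)) => k.
  have mE := measurable_run_length Y [set o | enat_ge k.+1 o].
  have -> : (fun w => (enat_ge k.+1 (run_length A Y w))%:R) =
      \1_[set w | enat_ge k.+1 (run_length A Y w)] :> (T -> R).
    by apply/funext => w; rewrite indicE; congr (_ %:R); rewrite mem_setE.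
  split; first exact: integrable_indic.
  by rewrite /Rintegral integral_indic// setIT.
rewrite /Rintegral fineK; last exact: integrable_fin_num.
apply: ge0_le_integral => //.
- by move=> w _; rewrite lee_fin sumr_ge0.
- exact: (measurable_int P fi).
- by move=> _ B mB; rewrite setTI; exact: (measurable_run_length Y (enat_val R @^-1` B)).
- by move=> w _; exact: sum_enat_ge.
Qed.

Let measurable_sample_preimage Y (B : set (aux_space A * real_seq R)) :
  measurable B -> measurable [set w | B (sample Y w)].
Proof.
move=> mB; rewrite -[X in measurable X]setTI.
exact: (measurable_sample Y measurableT mB).
Qed.

(** Markov's inequality: the continuation probabilities decrease, so each of the first [m] is at
    least [prob_continues Y m]. *)
Lemma prob_continues_le Y m (n : R) :
  (expected_cost A Y <= n%:E)%E -> m%:R * prob_continues Y m <= n.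
Proof.
move=> costn; rewrite -lee_fin; apply: le_trans costn.
apply: le_trans (sum_prob_continues Y m); rewrite lee_fin.
rewrite mulr_natl -[X in _ *+ X]card_ord -sumr_const ler_sum// => k _.
rewrite fine_le ?fin_num_measure ?le_measure ?inE//;
  try exact: measurable_sample_preimage.
move=> w; rewrite /continues /sample /stop_rule/=.
by case: (stop _) => //= j; apply: leq_trans; rewrite ltnS ltnW.
Qed.

Let measurable_error Y (eps mu : R) :
  measurable [set w | (`|run_output A Y w - mu| <= eps)%R].
Proof.
have := measurable_run_output Y measurableT
  (measurable_itv `[mu - eps, mu + eps]).
rewrite setTI; congr (measurable _).
by apply/seteqP; split => w; rewrite /= in_itv/= ler_distl.
Qed.

(** An output within [eps] of a mean above [eps] is positive, so an accurate run is accepted unless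
    it is truncated. *)
Lemma prob_accepts_ge Y m (eps delta mu : R) :
  (1 - delta%:E <= P [set w | (`|run_output A Y w - mu| <= eps)%R])%E ->
  eps < mu -> 1 - delta - prob_continues Y m <= prob_accepts Y m.
Proof.
set G := [set w | _] => PG epsmu.
have mG : measurable G by exact: measurable_error.
have mc := measurable_sample_preimage Y (measurable_continues m).
have ma := measurable_sample_preimage Y (measurable_accepts_by m).
rewrite lerBlDr -lee_fin EFinB; apply: (le_trans PG).
rewrite EFinD !fineK ?fin_num_measure//.
apply: le_trans (measureU2 _ ma mc); apply: le_measure; rewrite ?inE//.
  exact: measurableU.
move=> w; rewrite /G/= ler_distl => /andP[lo _].
have [cw|ncw] := boolP (enat_ge m.+1 (run_length A Y w)); [by right|left].
case E : (run_length A Y w) ncw => [k|]//= ncw.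
exists k; first by rewrite /= leqNgt.
split; first exact: E.
rewrite -E; apply: lt_le_trans lo; lra.
Qed.

(** An output within [eps] of a mean below [- eps] is negative; truncation only rejects and adds no
    error here. *)
Lemma prob_accepts_le Y m (eps delta mu : R) :
  (1 - delta%:E <= P [set w | (`|run_output A Y w - mu| <= eps)%R])%E ->
  mu < - eps -> prob_accepts Y m <= delta.
Proof.
set G := [set w | _] => PG epsmu.
have mG : measurable G by exact: measurable_error.
have ma := measurable_sample_preimage Y (measurable_accepts_by m).
have : (P [set w | accepts_by m (sample Y w)] <= P (~` G))%E.
  apply: le_measure; rewrite ?inE//; first exact: measurableC.
  move=> w [k _ [sk pk]]; rewrite /G/= ler_distl => /andP[_].
  rewrite /run_output (_ : run_length A Y w = Some k)//.
  by move=> hi; move: pk => /=; lra.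
rewrite probability_setC// -lee_fin fineK ?fin_num_measure// => /le_trans; apply.
rewrite leeBlDr ?fin_num_measure// -leeBlDl//.
Qed.

Lemma cost_lower_bound (Y1 Y2 : {RV P >-> R}) (s x eps delta n : R) :
  C Y1 -> C Y2 -> 0 < s -> 0 < x <= 2^-1 -> 0 < eps < s * x ->
  0 < delta <= 1 / 4 ->
  P (Y1 @^-1` [set s]) = ((1 + x) / 2)%:E ->
  P (Y1 @^-1` [set - s]) = ((1 - x) / 2)%:E ->
  P (Y2 @^-1` [set s]) = ((1 - x) / 2)%:E ->
  P (Y2 @^-1` [set - s]) = ((1 + x) / 2)%:E ->
  fine 'E_P[Y1]%E = s * x -> fine 'E_P[Y2]%E = - (s * x) ->
  approximating A eps delta -> (expected_cost A Y1 <= n%:E)%E ->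
  ln ((4 / 3 * delta)^-1) / (4 * ln 3 * x ^+ 2) <= n.
Proof.
move=> CY1 CY2 s0 /andP[x0 x2] /andP[eps0 epssx] /andP[delta0 delta4].
move=> Y1s Y1Ns Y2s Y2Ns E1 E2 apx cost.
have ln3 : 0 < ln 3 :> R by rewrite ln_gt0; lra.
set L := ln ((1 - delta) / delta).
(* This number and its inverse serve as [c1] and [c2]: they are the likelihood ratios of acceptance
   and rejection when both errors equal [delta]. *)
have c0 : 0 < (1 - delta) / delta by rewrite divr_gt0; lra.
have L0 : 0 <= L by rewrite ln_ge0// ler_pdivlMr; lra.
(* The bound for truncation at [m]; the loss [2 * (n / m%:R)] is the Markov estimate of the
   truncation probability. *)
have main m : (0 < m)%N ->
    L * (1 - 2 * delta - 2 * (n / m%:R)) <= 2 * ln 3 * x ^+ 2 * n.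
  move=> m0; have m0' : 0 < m%:R :> R by rewrite ltr0n.
  have p_eq : 1 - (1 + x) / 2 = (1 - x) / 2 by field.
  have p01 : 0 < (1 + x) / 2 < 1 by lra.
  have dep k u y y' : (forall j, (j < k)%N -> y j = y' j) ->
      continues k (u, y) -> continues k (u, y').
    move=> yy'; rewrite /continues/= /stop_rule.
    by rewrite (@stop_nonanticipating _ _ _ _ _ A k.+1 u y y').
  have mono k z : continues k.+1 z -> continues k z.
    by rewrite /continues/=; case: (stop_rule z) => //= j; exact: ltnW.
  have stopped z : accepts_by m z -> ~ continues m z.
    move=> [k km [rk _]]; rewrite /continues/= rk/=; apply/negP.
    by rewrite -leqNgt.
  have law Y (CY : C Y) v i : P (copies A Y i @^-1` [set v]) = P (Y @^-1` [set v]).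
    exact: (copies_law A CY i (measurable_set1 v)).
  pose v (b : bool) := if b then s else - s.
  have v_neq : v true <> v false by rewrite /v; lra.
  have l1t i : P (copies A Y1 i @^-1` [set v true]) = ((1 + x) / 2)%:E.
    by rewrite law.
  have l1f i : P (copies A Y1 i @^-1` [set v false]) = (1 - (1 + x) / 2)%:E.
    by rewrite law// p_eq.
  have l2t i : P (copies A Y2 i @^-1` [set v true]) = (1 - (1 + x) / 2)%:E.
    by rewrite law// p_eq.
  have l2f i : P (copies A Y2 i @^-1` [set v false]) = ((1 + x) / 2)%:E.
    by rewrite law.
  have c20 : 0 < ((1 - delta) / delta)^-1 by rewrite invr_gt0.
  have := stopped_two_point_test measurable_continues
    (measurable_accepts_by m) dep mono (accepts_dep (m := m)) stopped
    (copies_independent CY1) (copies_independent CY2)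
    l1t l1f l2t l2f v_neq p01 c0 c20.
  rewrite lnV// -/L.
  rewrite -/(prob_accepts Y1 m) -/(prob_accepts Y2 m).
  under eq_bigr do rewrite -/(prob_continues Y1 _).
  have S0 : 0 <= \sum_(k < m) prob_continues Y1 k by apply: sumr_ge0 => k _; exact: fine_ge0.
  have Sn : \sum_(k < m) prob_continues Y1 k <= n.
    by rewrite -lee_fin; exact: le_trans (sum_prob_continues Y1 m) cost.
  have a1 : 1 - delta - prob_continues Y1 m <= prob_accepts Y1 m.
    apply: prob_accepts_ge epssx; rewrite -E1 -EFinB; exact: apx.
  have b2 : prob_accepts Y2 m <= delta.
    apply: (@prob_accepts_le Y2 m eps delta (- (s * x))); last by lra.
    rewrite -E2 -EFinB; exact: apx.
  have cm : prob_continues Y1 m <= n / m%:R.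
    by rewrite ler_pdivlMr// mulrC; exact: prob_continues_le.
  have kl : coin_divergence ((1 + x) / 2) <= 2 * ln 3 * x ^+ 2.
    by apply: coin_divergence_le; rewrite x0.
  have klS := ler_wpM2r S0 kl.
  have ln3x : 0 <= 2 * ln 3 * x ^+ 2 by rewrite !mulr_ge0// ?ltW// exprn_gt0.
  have klSn := ler_wpM2l ln3x Sn.
  have ca1 : L * (1 - delta - n / m%:R) <= L * prob_accepts Y1 m.
    by apply: ler_wpM2l => //; lra.
  have cc : 0 <= (1 - delta) / delta - ((1 - delta) / delta)^-1.
    rewrite invf_div subr_ge0 ler_pdivrMr; last by lra.
    by rewrite mulrAC ler_pdivlMr//; nra.
  have cb := ler_wpM2l cc b2.
  (* With these multipliers the terms without logarithm add up to at most [1] and cancel the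
     left-hand side of the test inequality. *)
  have c_eq : ((1 - delta) / delta)^-1 +
      ((1 - delta) / delta - ((1 - delta) / delta)^-1) * delta = 1.
    by field; rewrite !gt_eqF//; lra.
  move=> test; lra.
have half := @binary_divergence_ge R delta.
rewrite delta0 delta4 in half.
have {}half := half isT; rewrite -/L in half.
set B := 2 * ln 3 * x ^+ 2 in main.
have B0 : 0 < B by rewrite !mulr_gt0// exprn_gt0.
have n0 : 0 <= n.
  rewrite -lee_fin; apply: le_trans cost.
  by apply: le_trans (sum_prob_continues Y1 0); rewrite big_ord0.
have LB : L * (1 - 2 * delta) <= B * n.
  rewrite leNgt; apply/negP => gap.
  set g := L * (1 - 2 * delta) - B * n.
  have g0 : 0 < g by rewrite subr_gt0.
  (* In place of a limit, [m] is taken so large that the truncation loss is smaller than the gap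
     [g]. *)
  pose m := (Num.trunc (2 * L * n / g)).+1.
  have mlt : 2 * L * n / g < m%:R by exact: truncnS_gt.
  have m0 : 0 < m%:R :> R by rewrite ltr0n.
  have := main m isT.
  rewrite ltr_pdivrMr// in mlt.
  have : 2 * L * n / m%:R < g by rewrite ltr_pdivrMr// (mulrC g).
  by rewrite /g; lra.
rewrite ler_pdivrMr; last by rewrite !mulr_gt0// exprn_gt0.
by move: LB half; rewrite /B; lra.
Qed.

End AlgorithmOnTwoPointInputs.

(** * Worst case complexity of the class *)

Theorem theorem3p9 (R : realType) (d : measure_display) (T : measurableType d)
    (P : probability T R) (hP : rich P)
    (p q : \bar R) (K sigma : R)
    (hp : (1 <= p)%E) (hpq : (p < q)%E) (hq : (2%:E <= q)%E)
    (hK : 1 < K) (hsigma : 0 < sigma)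
    (eps delta : R)
    (heps : 0 < eps)
    (heps' : eps <= Num.min (1 - 2 / (K + 1)) (1 / 2) * sigma)
    (hdelta : 0 < delta) (hdelta' : delta <= 1 / 4) :
  ((1 / (4 * ln 3) * (sigma / eps) ^+ 2 * ln ((4 / 3 * delta)^-1))%:E <=
    worst_complexity eps delta (class_Y P p q K `&` sigma_ball2 P sigma))%E.
Proof.
apply: le_ereal_inf_tmp => _ [n [n0 [A [apx cost]]] <-].
pose x := eps / sigma.
have x0 : 0 < x by rewrite divr_gt0.
have : x <= Num.min (1 - 2 / (K + 1)) (1 / 2) by rewrite ler_pdivrMr.
rewrite le_min div1r => /andP[xK x2].
(* The bound [1 - 2 / (K + 1)] on [x] is the condition [(1 + x) / (1 - x) <= K] solved for [x]. *)
have {}xK : 1 + x <= K * (1 - x).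
  have K1 : 0 < K + 1 by lra.
  have : x * (K + 1) <= K - 1.
    by rewrite -ler_pdivlMr// (_ : _ / _ = 1 - 2 / (K + 1))//; field; rewrite gt_eqF.
  by lra.
pose r := Num.sqrt (1 - x ^+ 2).
have x21 : 0 < 1 - x ^+ 2 by nra.
have r2 : r ^+ 2 = 1 - x ^+ 2 by rewrite sqr_sqrtr// ltW.
have r0 : 0 < r by rewrite sqrtr_gt0.
(* Strictness here gives [sigma < s], hence [eps < s * x], so accurate outputs have the sign of the
   mean. *)
have r1 : r < 1 by nra.
pose s := sigma / r.
have s0 : 0 < s by rewrite divr_gt0.
have ssig : sigma < s by rewrite ltr_pdivlMr// gtr_pMr.
have sx : eps < s * x.
  have -> : eps = sigma * x by rewrite /x mulrC divfK// gt_eqF.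
  by rewrite ltr_pM2r.
have s2 : s ^+ 2 - (s * x) ^+ 2 = sigma ^+ 2.
  rewrite (_ : _ - _ = s ^+ 2 * (1 - x ^+ 2)); last by ring.
  by rewrite -r2 -exprMn /s divfK// gt_eqF.
have p1 : 0 <= (1 + x) / 2 <= 1 by lra.
have p2 : 0 <= (1 - x) / 2 <= 1 by lra.
have [Y1 [Y1v Y1s Y1Ns Y1m]] := rich_two_point hP s0 p1.
have [Y2 [Y2v Y2s Y2Ns Y2m]] := rich_two_point hP s0 p2.
have sx0 : 0 < s * x by rewrite mulr_gt0.
have sxs : s * x < s by rewrite gtr_pMr//; lra.
have sK : s + s * x <= K * (s - s * x).
  rewrite (_ : s + s * x = s * (1 + x)); last by ring.
  by rewrite (_ : K * _ = s * (K * (1 - x))) ?ler_pM2l//; ring.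
have {}Y1m : has_mean P Y1 (s * x).
  by rewrite (_ : s * x = s * (2 * ((1 + x) / 2) - 1))//; field.
have {}Y2m : has_mean P Y2 (- (s * x)).
  by rewrite (_ : - (s * x) = s * (2 * ((1 - x) / 2) - 1))//; field.
have CY1 : (class_Y P p q K `&` sigma_ball2 P sigma) Y1.
  by apply: (two_point_in_class (s := s) hp hpq s0 _ _ s2) => //; rewrite gtr0_norm.
have CY2 : (class_Y P p q K `&` sigma_ball2 P sigma) Y2.
  apply: (two_point_in_class (s := s) hp hpq s0 _ _ _ _ _ Y2m) => //;
    by rewrite ?normrN ?gtr0_norm ?sqrrN.
have cost1 : (expected_cost A Y1 <= n%:E)%E.
  by apply: le_trans cost; apply: ereal_sup_ubound; exists Y1.
rewrite lee_fin.
have bound_eq (l t : R) : 0 < t ->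
    1 / (4 * t) * (sigma / eps) ^+ 2 * l = l / (4 * t * x ^+ 2).
  by move=> t0; rewrite /x; field; rewrite !gt_eqF.
rewrite bound_eq; last by rewrite ln_gt0 ?ltr1n.
apply: (cost_lower_bound (Y1 := Y1) (Y2 := Y2) (s := s) (eps := eps)
  CY1 CY2 s0 _ _ _ Y1s _ Y2s _ _ _ apx cost1).
- by rewrite x0 x2.
- by rewrite heps sx.
- by rewrite hdelta hdelta'.
- by rewrite Y1Ns; congr EFin; field.
- by rewrite Y2Ns; congr EFin; field.
- exact: has_mean_expectation.
- exact: has_mean_expectation.
Qed.
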